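(* Let $d$ and $n$ be positive integers, and let $\Theta_n = \{\vec{\theta}_1, \ldots, \vec{\theta}_n\}$ be a set of $n$ vectors in $\mathbf{R}^d$ that are linearly independent over $\mathbf{Q}$, with $\vec{\theta}_i = (\theta_{i,1}, \ldots, \theta_{i,d})$. Let $h \geq 2$ be an integer, and let $$\varepsilon_{h,n} = \inf\left\{ \left\| \sum_{i=1}^n (x_i - y_i)\vec{\theta}_i \right\|_\infty : \mathbf{x}, \mathbf{y} \in \mathcal{X}_{h,n},\ \mathbf{x} \neq \mathbf{y} \right\},$$ where $\mathcal{X}_{h,n} = \{ (x_1,\ldots,x_n) \in \mathbf{N}_0^n : \sum_{i=1}^n x_i = h\}$. Let $q$ and $m$ be positive integers with $$q > \frac{2hm}{\varepsilon_{h,n}}.$$ For each of the $(2m)^{dn}$ choices of integers $a_{i,j}$ ($1 \le i \le n$, $1 \le j \le d$) satisfying $$0 < |a_{i,j} - q\theta_{i,j}| \leq m \quad \text{for all } i, j,$$ put $\vec{a}_i = (a_{i,1},\ldots,a_{i,d}) \in \mathbf{Z}^d$ and $A_{h,n}(q,m) = \{\vec{a}_1,\ldots,\vec{a}_n\}$. Then each of these sets $A_{h,n}(q,m)$ is a $B_h$-set of lattice points in $\mathbf{Z}^d$, and $$\|A_{h,n}(q,m)\|_\infty \leq q\,\|\Theta_n\|_\infty + m.$$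
   Context: $\mathbf{N}_0$ denotes the set of nonnegative integers. For a vector $\vec{v} = (v_1,\ldots,v_d) \in \mathbf{R}^d$, $\|\vec{v}\|_\infty = \max_{1 \le j \le d} |v_j|$. For a finite set of vectors $V = \{\vec{v}_1,\ldots,\vec{v}_n\}$, $\|V\|_\infty = \max_{1\le i \le n} \|\vec{v}_i\|_\infty$. A nonempty subset $A$ of an additive abelian group $G$ is a $B_h$-set if every $g \in G$ has at most one representation as a sum of $h$ not necessarily distinct elements of $A$, where representations differing only by a permutation of the summands are identified. For each pair $(i,j)$ there are exactly $2m$ integers $a_{i,j}$ with $0 < |a_{i,j} - q\theta_{i,j}| \le m$, so there are $(2m)^{dn}$ choices in total. If $n = 1$, the infimum defining $\varepsilon_{h,n}$ is over the empty set and is read as $+\infty$, so that the condition on $q$ is vacuous. *)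

(* Defs.v *)
From HB Require Import structures.
From mathcomp Require Import all_boot all_order all_algebra.
From mathcomp Require Import all_classical all_reals all_analysis.

Set Implicit Arguments.
Unset Strict Implicit.
Unset Printing Implicit Defensive.

Import Order.TTheory GRing.Theory Num.Theory.
Import numFieldNormedType.Exports.

Local Open Scope classical_set_scope.
Local Open Scope ring_scope.

(* A family of n vectors of R^d (resp. Z^d) is encoded by the n x d matrix
   whose i-th row is the i-th vector. *)

Definition Q_lin_indep (R : realType) (n d : nat) (theta : 'M[R]_(n, d)) : Prop :=
  forall c : 'I_n -> rat,
    \sum_(i < n) ratr (c i) *: row i theta = 0 -> forall i, c i = 0.

(* The library norm `|v| of a row vector is the maximum of the absolute values
   of its coordinates, see mx_normrE. *)
Definition family_norm (R : realType) (n d : nat) (v : 'M[R]_(n, d)) : R :=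
  \big[Num.max/0]_(i < n) `|row i v|.

Definition row_set (T : Type) (n d : nat) (v : 'M[T]_(n, d)) : set 'rV[T]_d :=
  [set row i v | i in [set: 'I_n]].

(* Representations of g as a sum of h elements of A are h-tuples, identified
   when they are permutations of each other. *)
Definition is_Bh_set (G : zmodType) (h : nat) (A : set G) : Prop :=
  A !=set0 /\
  forall (g : G) (s t : h.-tuple G),
    (forall x, x \in s -> A x) -> (forall x, x \in t -> A x) ->
    \sum_(x <- s) x = g -> \sum_(x <- t) x = g -> perm_eq s t.

Definition weights (h n : nat) : set {ffun 'I_n -> nat} :=
  [set x | (\sum_(i < n) x i)%N = h].

(* Extended-real infimum, so that the infimum over the empty set (which occurs
   when n = 1) is +oo. *)
Definition epsilon (R : realType) (n d h : nat) (theta : 'M[R]_(n, d)) : \bar R :=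
  ereal_inf [set e : \bar R | exists x y : {ffun 'I_n -> nat},
    [/\ weights h x, weights h y, x <> y &
        e = `| \sum_(i < n) ((x i)%:R - (y i)%:R) *: row i theta |%:E]].

Definition admissible (R : realType) (n d : nat) (theta : 'M[R]_(n, d))
    (q m : nat) : set 'M[int]_(n, d) :=
  [set a | forall i j, 0 < `|(a i j)%:~R - q%:R * theta i j| <= m%:R].

(* Main.v *)
Require Import Defs.
From HB Require Import structures.
From mathcomp Require Import all_boot all_order all_algebra.
From mathcomp Require Import all_classical all_reals all_analysis.
From mathcomp Require Import ring lra zify.

Set Implicit Arguments.
Unset Strict Implicit.
Unset Printing Implicit Defensive.

Import Order.TTheory GRing.Theory Num.Theory.
Import numFieldNormedType.Exports.

Local Open Scope classical_set_scope.
Local Open Scope ring_scope.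

(* Suppose x and y are distinct weight vectors of total h giving the same sum of
   the rows a_i. Then q sum_i (x_i - y_i) theta_i equals
   - sum_i (x_i - y_i) (a_i - q theta_i), whose coordinates are at most
   sum_i (x_i + y_i) m = 2hm in absolute value. Hence q epsilon <= 2hm, against
   the choice of q. *)

Lemma card_eq_finType (T : finType) : ([set: T] #= `I_#|T|)%card.
Proof.
have inj : {in [set: T] &, injective (fun x : T => enum_rank x : nat)}.
  by move=> x y _ _ /ord_inj /enum_rank_inj.
rewrite card_eq_sym; apply: card_eq_trans (inj_card_eq inj).
apply/card_eqPle; split; apply: subset_card_le.
  move=> k /= ltk; exists (enum_val (Ordinal ltk)) => //.
  by rewrite enum_valK.
by move=> _ [x _ <-] /=; exact: ltn_ord.
Qed.

(** Excluding [a = x] leaves one side of [x] or the other. As [a] is an integer, above [x] both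
    bounds can be read off the floor ([a - m <= x] is a condition on the floor too), and below [x]
    off the ceiling. *)
Lemma window_floor_ceil (R : realType) (x : R) (m : nat) (a : int) :
  (0 < `|a%:~R - x| <= m%:R) =
  (Num.floor x < a <= Num.floor x + m%:Z) ||
  (Num.ceil x - m%:Z <= a < Num.ceil x).
Proof.
have natrE : (m%:R : R) = m%:Z%:~R by [].
rewrite floor_lt_int ceil_gt_int -lerBlDr floor_ge_int_tmp lerBlDr ceil_le_int.
rewrite rmorphB rmorphD /= -natrE normr_gt0 subr_eq0 ler_norml.
have m_ge0 : (0 : R) <= m%:R by [].
rewrite neq_lt.
by apply/idP/idP; lra.
Qed.

(* Counting up from the floor and down from the ceiling treats integer and
   non-integer x uniformly. *)
Definition window_elt (R : realType) (m : nat) (x : R) (k : bool * 'I_m) : int :=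
  if k.1 then Num.floor x + 1 + (k.2 : nat)%:Z else Num.ceil x - 1 - (k.2 : nat)%:Z.

Lemma window_elt_inj (R : realType) (m : nat) (x : R) :
  injective (@window_elt R m x).
Proof.
(* An ascending and a descending value can coincide only if the ceiling exceeds the floor by at
   least 2. *)
have ceil_bounds : Num.floor x <= Num.ceil x <= Num.floor x + 1.
  rewrite ceil_floor; case: (x \isn't a Num.int);
  by rewrite ?addr0 lexx ?lerDl ?andbT.
move=> [[] i] [[] j]; rewrite /window_elt /= => e;
  (suff -> : i = j by []) || exfalso; try apply: val_inj => /=; lia.
Qed.

Lemma window_eltP (R : realType) (m : nat) (x : R) (a : int) :
  reflect (exists k : bool * 'I_m, window_elt x k = a) (0 < `|a%:~R - x| <= m%:R).
Proof.
rewrite window_floor_ceil; apply: (iffP idP) => [/orP[] /andP[lo hi]|[[b k] <-]].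
- have ltk : (`|(a - (Num.floor x + 1))%R| < m)%N by lia.
  by exists (true, Ordinal ltk); rewrite /window_elt /=; lia.
- have ltk : (`|(Num.ceil x - 1 - a)%R| < m)%N by lia.
  by exists (false, Ordinal ltk); rewrite /window_elt /=; lia.
- by have := ltn_ord k; rewrite /window_elt; case: b => /=; lia.
Qed.

(** The entries are chosen independently, each from a window of [2 * m] integers indexed by
    [bool * 'I_m], so matrices of indices parametrize the admissible matrices injectively. *)
Lemma card_admissible (R : realType) (n d : nat) (theta : 'M[R]_(n, d)) (q m : nat) :
  (admissible theta q m #= `I_((2 * m) ^ (d * n)))%card.
Proof.
pose F (k : 'M[bool * 'I_m]_(n, d)) : 'M[int]_(n, d) :=
  \matrix_(i, j) window_elt (q%:R * theta i j) (k i j).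
have F_inj : {in [set: 'M[bool * 'I_m]_(n, d)] &, injective F}.
  move=> k l _ _ /matrixP e; apply/matrixP => i j.
  by have := e i j; rewrite !mxE; exact: window_elt_inj.
have -> : admissible theta q m = [set F k | k in setT].
  apply/seteqP; split=> [a adm|_ [k _ <-] i j].
    have ex i j : exists k : bool * 'I_m, window_elt (q%:R * theta i j) k = a i j.
      exact/window_eltP/adm.
    exists (\matrix_(i, j) sval (cid (ex i j))) => //.
    by apply/matrixP => i j; rewrite !mxE; exact: svalP (cid (ex i j)).
  by rewrite mxE; apply/window_eltP; exists (k i j).
rewrite (card_eql (inj_card_eq F_inj)).
have -> : ((2 * m) ^ (d * n) = #|{: 'M[bool * 'I_m]_(n, d)}|)%N.
  by rewrite card_mx card_prod card_bool card_ord (mulnC d).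
exact: card_eq_finType.
Qed.

Lemma ler_rV_norm (R : realType) (d : nat) (v : 'rV[R]_d) (c : R) :
  0 <= c -> (`|v| <= c) <-> (forall j, `|v 0 j| <= c).
Proof.
move=> c_ge0; rewrite /Num.norm /= mx_normrE; split=> [le j|le].
  by apply: le_trans le; exact: (le_bigmax _ (fun ij => `|v ij.1 ij.2|) (0, j)).
by apply: bigmax_le => // -[i j] _ /=; rewrite ord1; exact: le.
Qed.

Lemma family_norm_admissible (R : realType) (n d : nat) (theta : 'M[R]_(n, d))
    (q m : nat) (a : 'M[int]_(n, d)) :
  admissible theta q m a ->
  family_norm (map_mx intr a : 'M[R]_(n, d)) <= q%:R * family_norm theta + m%:R.
Proof.
move=> adm; have bound_ge0 : 0 <= q%:R * family_norm theta + m%:R.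
  by rewrite addr_ge0 ?mulr_ge0 // /family_norm bigmax_ge_id.
apply: bigmax_le => // i _; apply/ler_rV_norm => // j; rewrite !mxE.
have /andP[_ near] := adm i j.
(* Triangle inequality for [a i j] split as [q * theta i j] plus an error of size at most [m]. *)
rewrite -(subrK (q%:R * theta i j) (a i j)%:~R) addrC.
apply: le_trans (ler_normD _ _) _; rewrite lerD // normrM ger0_norm //.
rewrite ler_wpM2l //.
apply: (@le_trans _ _ `|row i theta|); last exact: le_bigmax.
by have /ler_rV_norm/(_ j) := lexx `|row i theta|; rewrite mxE; exact.
Qed.

Lemma epsilon_lt (R : realType) (n d h : nat) (theta : 'M[R]_(n, d)) (K q : R)
    (x y : {ffun 'I_n -> nat}) :
  0 < K -> (K%:E / epsilon h theta < q%:E)%E ->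
  weights h x -> weights h y -> x <> y ->
  K < q * `| \sum_(i < n) ((x i)%:R - (y i)%:R) *: row i theta |.
Proof.
move=> K_gt0 q_large wx wy neq_xy; set v := \sum_(i < n) _.
have eps_le : (epsilon h theta <= `|v|%:E)%E.
  by apply: ereal_inf_lbound; exists x, y.
have eps_ge0 : (0 <= epsilon h theta)%E.
  by apply: le_ereal_inf_tmp => _ [? [? [_ _ _ ->]]]; rewrite lee_fin.
(* Lying between 0 and a real number, the infimum is finite. *)
move: eps_le eps_ge0 q_large; case: (epsilon h theta) => // e.
rewrite !lee_fin => le_ev e_ge0; rewrite inver.
(* In [\bar R] a positive number divided by 0 is +oo, which excludes e = 0. *)
case: eqVneq => [_|e_neq0]; first by rewrite gt0_muley ?lte_fin.
have e_gt0 : 0 < e by rewrite lt_def e_neq0.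
rewrite -EFinM lte_fin ltr_pdivrMr // => lt; apply: (lt_le_trans lt).
(* The sign of [q] comes from [0 < K < q * e]. *)
rewrite ler_wpM2l //; apply: ltW.
by rewrite -(pmulr_lgt0 _ e_gt0) (lt_trans K_gt0 lt).
Qed.

Lemma admissible_combination_bound (R : realType) (n d : nat)
    (theta : 'M[R]_(n, d)) (h q m : nat) (a : 'M[int]_(n, d))
    (x y : {ffun 'I_n -> nat}) :
  admissible theta q m a -> weights h x -> weights h y ->
  \sum_(i < n) row i a *+ x i = \sum_(i < n) row i a *+ y i ->
  q%:R * `| \sum_(i < n) ((x i)%:R - (y i)%:R) *: row i theta | <= (2 * h * m)%:R.
Proof.
move=> adm wx wy eq_sum.
rewrite -[q%:R]ger0_norm // -normrZ; apply/ler_rV_norm => // j.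
have eq_j : \sum_(i < n) ((x i)%:R - (y i)%:R) * (a i j)%:~R = 0 :> R.
  under eq_bigr do rewrite mulrBl; rewrite sumrB; apply/eqP; rewrite subr_eq0.
  move/rowP/(_ j): eq_sum => /(congr1 (fun z : int => z%:~R : R)).
  rewrite !summxE !rmorph_sum /= => e; apply/eqP.
  have sumE (z : {ffun 'I_n -> nat}) :
      \sum_(i < n) (z i)%:R * (a i j)%:~R =
      \sum_(i < n) ((row i a *+ z i) 0 j)%:~R :> R.
    by apply: eq_bigr => i _; rewrite mulmxnE mxE rmorphMn /= mulr_natl.
  by rewrite !sumE.
rewrite !mxE summxE mulr_sumr.
under eq_bigr do rewrite !mxE.
(* After a change of sign, adding the vanishing sum [eq_j] pairs each [q * theta i j] with [a i j],
   leaving only the approximation errors. *)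
rewrite -[leLHS]normrN -sumrN -[X in `|X|]addr0 -[X in _ + X]eq_j -big_split /=.
apply: le_trans (ler_norm_sum _ _ _) _.
(* The crude bound of [x i - y i] by [x i + y i] suffices: these add up to [2 * h]. *)
apply: (@le_trans _ _ (\sum_(i < n) ((x i)%:R + (y i)%:R) * m%:R)); last first.
  rewrite -mulr_suml big_split /= -!natr_sum wx wy -natrD -natrM.
  by rewrite addnn -mul2n.
apply: ler_sum => i _.
have -> : - (q%:R * (((x i)%:R - (y i)%:R) * theta i j)) +
    ((x i)%:R - (y i)%:R) * (a i j)%:~R =
    ((x i)%:R - (y i)%:R) * ((a i j)%:~R - q%:R * theta i j) by ring.
rewrite normrM ler_pM //; last by have /andP[] := adm i j.
by apply: le_trans (ler_normB _ _) _; rewrite !ger0_norm.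
Qed.

Lemma sum_count (V : nmodType) (T : Type) (I : finType) (f : T -> I) (F : I -> V)
    (s : seq T) :
  \sum_(x <- s) F (f x) = \sum_i F i *+ count (fun x => f x == i) s.
Proof.
rewrite (partition_big f xpredT) //=; apply: eq_bigr => i _.
rewrite -iter_addr_0 -big_const_seq.
by apply: eq_bigr => x /eqP ->.
Qed.

(** Choosing an index for each row turns an [h]-tuple of rows into a vector of multiplicities of
    total [h] with the same sum. Equal multiplicities make the index lists, hence the tuples,
    permutations of each other. *)
Lemma is_Bh_row_set (h n d : nat) (a : 'M[int]_(n, d)) :
  (0 < n)%N ->
  (forall x y : {ffun 'I_n -> nat}, weights h x -> weights h y ->
     \sum_(i < n) row i a *+ x i = \sum_(i < n) row i a *+ y i -> x = y) ->
  is_Bh_set h (row_set a).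
Proof.
case: n a => // n a _ uniq_rep; split; first by exists (row ord0 a), ord0.
move=> g s t s_in t_in sum_s sum_t.
(* The default [ord0] makes [f] total, so the counts of any [h]-tuple add up to [h]; only on rows of
   [a] is [f] a section of [row]. *)
pose f (z : 'rV[int]_d) : 'I_n.+1 := odflt ord0 [pick i | row i a == z].
have fK z : row_set a z -> row (f z) a = z.
  move=> [i _ <-]; rewrite /f; case: pickP => [k /eqP //|/(_ i)].
  by rewrite eqxx.
pose cnt (u : seq 'rV[int]_d) := [ffun i => count (fun z => f z == i) u].
have cnt_weights (u : h.-tuple 'rV[int]_d) : weights h (cnt u).
  rewrite /weights /=; under eq_bigr do rewrite ffunE.
  rewrite -[RHS](size_tuple u) -sum1_size (partition_big f xpredT) //=.
  by apply: eq_bigr => i _; rewrite sum1_count.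
have cnt_sum (u : seq 'rV[int]_d) : (forall z, z \in u -> row_set a z) ->
    \sum_i row i a *+ cnt u i = \sum_(z <- u) z.
  move=> u_in; under eq_bigr do rewrite ffunE.
  rewrite -sum_count big_seq [RHS]big_seq.
  by apply: eq_bigr => z /u_in/fK.
have cntE : cnt s = cnt t.
  by apply: uniq_rep => //; rewrite !cnt_sum // sum_s sum_t.
have mapK (u : seq 'rV[int]_d) : (forall z, z \in u -> row_set a z) ->
    [seq row i a | i <- map f u] = u.
  by move=> u_in; rewrite -map_comp -[RHS]map_id; apply/eq_in_map => z /u_in/fK.
rewrite -(mapK s s_in) -(mapK t t_in); apply: perm_map.
(* [perm_eq] is by definition equality of the counts of each entry, which is what [cntE] gives for
   the index lists. *)
apply/allP => i _ /=; rewrite !count_map; apply/eqP.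
by have /ffunP/(_ i) := cntE; rewrite !ffunE.
Qed.

Theorem theorem1 (R : realType) (d n : nat) (d_gt0 : (0 < d)%N) (n_gt0 : (0 < n)%N)
    (theta : 'M[R]_(n, d)) (theta_indep : Q_lin_indep theta)
    (h : nat) (h_ge2 : (2 <= h)%N)
    (q m : nat) (q_gt0 : (0 < q)%N) (m_gt0 : (0 < m)%N)
    (q_large : ((2 * h * m)%:R%:E / epsilon h theta < q%:R%:E)%E) :
  (admissible theta q m #= `I_((2 * m) ^ (d * n)))%card /\
  forall a : 'M[int]_(n, d), admissible theta q m a ->
    is_Bh_set h (row_set a) /\
    family_norm (map_mx intr a : 'M[R]_(n, d)) <= q%:R * family_norm theta + m%:R.
Proof.
split=> [|a adm]; first exact: card_admissible.
split; last exact: family_norm_admissible.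
apply: is_Bh_row_set => // x y wx wy eq_sum; apply: contrapT => neq_xy.
have K_gt0 : 0 < (2 * h * m)%:R :> R by rewrite ltr0n !muln_gt0 m_gt0 (ltnW h_ge2).
have := epsilon_lt K_gt0 q_large wx wy neq_xy.
by rewrite ltNge (admissible_combination_bound adm wx wy eq_sum).
Qed.
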